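(* As $d\to\infty$ (over positive integers $d$), $$\frac{1}{f_d\big(\eta_d(\tfrac{\pi}{2})\big)} < 2\Big(\frac{\pi}{2}\Big)^{2d-1} e^{(d\log d)/2}\,\big[1+O(d^{-1})\big];$$ that is, there exist constants $K>0$ and $d_0\ge 1$ such that for all integers $d\ge d_0$ one has $\frac{1}{f_d(\eta_d(\pi/2))} < 2(\pi/2)^{2d-1} e^{(d\log d)/2}\,(1+K/d)$.
   Context: For an integer $d\ge 1$, $\theta_d := \arccos(-1/d)$. For $0<\theta<\theta_d$, $\eta_d(\theta):=\arcsin\big(\frac{\sin(\theta/2)}{\sin(\theta_d/2)}\big)\in(0,\pi/2)$. For $\eta\in(0,\pi/2)$, $$f_d(\eta)=\Big(\int_0^{\pi}\sin^{d-1}(t)\,dt\Big)^{-1}\int_0^{\frac{\pi}{2}-\eta}\sin^{d-1}(t)\,dt .$$ Here $\log$ is the natural logarithm. *)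

(* Defs.v *)
From Stdlib Require Import Reals.
From Coquelicot Require Import Coquelicot.
Open Scope R_scope.

Definition theta_max (d : nat) : R := acos (- 1 / INR d).

(* Meaningful for 1 <= d and 0 < theta < theta_max d, where the argument of
   asin lies in (0, 1). *)
Definition cap_eta (d : nat) (theta : R) : R :=
  asin (sin (theta / 2) / sin (theta_max d / 2)).

(* Meaningful for 1 <= d, so that the truncated d - 1 is the true exponent, and
   0 < x < PI / 2. *)
Definition cap_frac (d : nat) (x : R) : R :=
  / (RInt (fun t : R => sin t ^ (d - 1)) 0 PI)
  * RInt (fun t : R => sin t ^ (d - 1)) 0 (PI / 2 - x).

(* Main.v *)
Require Import Defs.
From Stdlib Require Import Reals Lra Lia.
From Coquelicot Require Import Coquelicot.
Open Scope R_scope.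

(** Half of the maximal angle satisfies sin^2 = (1 + 1/d)/2, so the cap for
    theta = PI/2 has angular radius phi with sin phi = (d + 1)^(-1/2).
    Inserting the factor cos t <= 1 bounds the cap integral below by
    (sin phi)^d / d, and the full integral is at most PI.  Hence
    1 / f_d <= PI * d * (d + 1)^(d/2) <= PI * d * e * e^((d log d)/2),
    and the factor O(d) is absorbed by the exponential (PI/2)^(2d). *)

(** The extra factor [cos t] makes the integrand an exact derivative, which gives a closed form to
    compare with. *)
Lemma RInt_sin_pow_cos (n : nat) (x : R) :
  is_RInt (fun t => sin t ^ n * cos t) 0 x (sin x ^ S n / INR (S n)).
Proof.
  assert (Hn : INR (S n) <> 0) by (apply not_0_INR; lia).
  replace (sin x ^ S n / INR (S n))
    with (minus (sin x ^ S n / INR (S n)) (sin 0 ^ S n / INR (S n))).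
  2:{ change (sin x ^ S n / INR (S n) - sin 0 ^ S n / INR (S n) = sin x ^ S n / INR (S n)).
      rewrite sin_0, (pow_i (S n)) by lia. field; exact Hn. }
  apply (is_RInt_derive (fun t => sin t ^ S n / INR (S n))).
  - intros t _. auto_derive; [exact I |].
    field. exact Hn.
  - intros t _. apply (ex_derive_continuous (fun t => sin t ^ n * cos t)).
    auto_derive. exact I.
Qed.

Lemma ex_RInt_sin_pow (n : nat) (a b : R) : ex_RInt (fun t => sin t ^ n) a b.
Proof.
  apply (@ex_RInt_continuous R_CompleteNormedModule). intros t _.
  apply (ex_derive_continuous (fun t => sin t ^ n)). auto_derive. exact I.
Qed.

Lemma RInt_sin_pow_lower (n : nat) (x : R) :
  0 <= x <= PI -> sin x ^ S n / INR (S n) <= RInt (fun t => sin t ^ n) 0 x.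
Proof.
  intros Hx. rewrite <- (is_RInt_unique _ _ _ _ (RInt_sin_pow_cos n x)).
  apply RInt_le; [lra | eexists; apply RInt_sin_pow_cos
                 | apply ex_RInt_sin_pow | intros t Ht].
  assert (0 <= sin t ^ n) by (apply pow_le, sin_ge_0; lra).
  destruct (COS_bound t). nra.
Qed.

Lemma RInt_sin_pow_upper (n : nat) : RInt (fun t => sin t ^ n) 0 PI <= PI.
Proof.
  assert (HPI := PI_RGT_0).
  replace PI with (RInt (fun _ => 1) 0 PI) at 2.
  2:{ rewrite RInt_const. unfold scal; simpl; unfold mult; simpl; ring. }
  apply RInt_le; [lra | apply ex_RInt_sin_pow | apply ex_RInt_const | intros t Ht].
  rewrite <- (pow1 n). apply pow_incr. split.
  - apply sin_ge_0; lra.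
  - apply SIN_bound.
Qed.

Lemma sin_half_sqr (x : R) : sin (x / 2) ^ 2 = (1 - cos x) / 2.
Proof.
  replace (cos x) with (cos (2 * (x / 2))) by (f_equal; field).
  rewrite cos_2a_sin. field.
Qed.

Lemma cap_radius_half_pi (d : nat) : (1 <= d)%nat ->
  0 <= PI / 2 - cap_eta d (PI / 2) <= PI /\
  sin (PI / 2 - cap_eta d (PI / 2)) = / sqrt (INR d + 1).
Proof.
  intros Hd. apply le_INR in Hd. change (INR 1) with 1 in Hd.
  assert (Hi : 0 < / INR d <= 1).
  { split; [apply Rinv_0_lt_compat; lra |].
    rewrite <- Rinv_1. apply Rinv_le_contravar; lra. }
  assert (Hcos : cos (theta_max d) = - / INR d).
  { unfold theta_max. rewrite cos_acos; [field |]; unfold Rdiv; lra. }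
  assert (Hth : 0 < theta_max d <= PI).
  (* The angle cannot vanish: its cosine is negative, while [cos 0 = 1]. *)
  { destruct (acos_bound (-1 / INR d)) as [H0 H1]. fold (theta_max d) in H0, H1.
    split; [| exact H1]. destruct H0 as [H0 | H0]; [exact H0 |].
    rewrite <- H0, cos_0 in Hcos. lra. }
  assert (Hs := sin_half_sqr (theta_max d)). rewrite Hcos in Hs.
  assert (Hs0 : 0 < sin (theta_max d / 2)) by (apply sin_gt_0; lra).
  assert (Hp := sin_half_sqr (PI / 2)). rewrite cos_PI2 in Hp.
  assert (Hp0 : 0 < sin (PI / 2 / 2)) by (apply sin_gt_0; assert (h := PI_RGT_0); lra).
  unfold cap_eta.
  set (s := sin (theta_max d / 2)) in *. set (p := sin (PI / 2 / 2)) in *.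
  (* Here [p ^ 2 = 1/2] and [s ^ 2 = (1 + 1/d)/2], so the squared ratio is d/(d+1). *)
  assert (Hr2 : 1 - (p / s)² = / (INR d + 1)).
  { unfold Rsqr. replace (p / s * (p / s)) with (p ^ 2 / s ^ 2) by (field; lra).
    rewrite Hs, Hp. field. repeat split; lra. }
  assert (Hr0 : 0 < p / s) by (apply Rdiv_lt_0_compat; assumption).
  assert (0 < / (INR d + 1)) by (apply Rinv_0_lt_compat; lra).
  assert (Hr1 : p / s <= 1) by (unfold Rsqr in Hr2; nra).
  (* The complement of the arcsine is the arccosine, and the sine of [acos r] is the square root of
     1 - r^2. *)
  rewrite <- acos_asin by lra. split; [apply acos_bound |].
  rewrite sin_acos, Hr2 by lra. apply sqrt_inv.
Qed.

Lemma inv_cap_frac_le (d : nat) : (1 <= d)%nat ->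
  1 / cap_frac d (cap_eta d (PI / 2)) <= PI * (INR d * sqrt (INR d + 1) ^ d).
Proof.
  intros Hd. destruct (cap_radius_half_pi d Hd) as [Hphi Hsin].
  assert (Hs : 0 < sqrt (INR d + 1)).
  { apply sqrt_lt_R0. assert (h := pos_INR d). lra. }
  assert (Hd0 : 0 < INR d) by (apply lt_0_INR; lia).
  unfold cap_frac.
  assert (Hlow := RInt_sin_pow_lower (d - 1) _ Hphi).
  assert (Hup := RInt_sin_pow_upper (d - 1)).
  replace (S (d - 1)) with d in Hlow by lia.
  rewrite Hsin, pow_inv in Hlow.
  set (J := RInt _ 0 (PI / 2 - _)) in *. set (I := RInt _ 0 PI) in *.
  assert (HL : 0 < INR d * sqrt (INR d + 1) ^ d)
    by (apply Rmult_lt_0_compat; [| apply pow_lt]; assumption).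
  set (L := INR d * sqrt (INR d + 1) ^ d) in *.
  replace (/ sqrt (INR d + 1) ^ d / INR d) with (/ L) in Hlow.
  2:{ unfold L. field. split; [apply pow_nonzero |]; lra. }
  (* [J >= / L > 0] allows inversion, so [/ J <= L]; the quantity to bound is [I * / J]. *)
  assert (HJ : 0 < J) by (apply Rinv_0_lt_compat in HL; lra).
  assert (HJL : / J <= L).
  { rewrite <- (Rinv_inv L). apply Rinv_le_contravar; [apply Rinv_0_lt_compat |]; assumption. }
  unfold Rdiv. rewrite Rmult_1_l, Rinv_mult, Rinv_inv.
  apply Rinv_0_lt_compat in HJ. assert (h := PI_RGT_0).
  apply Rle_trans with (PI * / J).
  - apply Rmult_le_compat_r; lra.
  - apply Rmult_le_compat_l; lra.
Qed.

(** Split (d+1)^(d/2) as d^(d/2) (1+1/d)^(d/2); since ln(1+1/d) <= 1/d, the second factor is at most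
    e^(1/2), hence below 3. *)
Lemma sqrt_succ_pow_le (d : nat) : (1 <= d)%nat ->
  sqrt (INR d + 1) ^ d <= 3 * exp (INR d * ln (INR d) / 2).
Proof.
  intros Hd. assert (Hd0 : 0 < INR d) by (apply lt_0_INR; lia).
  assert (Hs : 0 < sqrt (INR d + 1)) by (apply sqrt_lt_R0; lra).
  rewrite <- Rpower_pow by exact Hs.
  rewrite <- (Rpower_sqrt (INR d + 1)) by lra. unfold Rpower. rewrite ln_exp.
  assert (Hln : ln (INR d + 1) <= ln (INR d) + / INR d).
  { replace (INR d + 1) with (INR d * (1 + / INR d)) by (field; lra).
    assert (Hi := Rinv_0_lt_compat _ Hd0).
    rewrite ln_mult by lra. apply Rplus_le_compat_l.
    rewrite <- (ln_exp (/ INR d)) at 2. apply ln_le; [lra | apply exp_ineq1_le]. }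
  (* The excess in the exponent is at most 1/2; rounding it up to 1 leaves the factor e <= 3. *)
  apply Rle_trans with (exp (1 + INR d * ln (INR d) / 2)).
  - left. apply exp_increasing.
    apply (Rmult_le_compat_l (INR d)) in Hln; [| lra].
    rewrite Rmult_plus_distr_l, Rinv_r in Hln by lra. lra.
  - rewrite exp_plus. apply Rmult_le_compat_r; [left; apply exp_pos | exact exp_le_3].
Qed.

(** Each step multiplies the right side by 9/4 and the left by at most 7/6; the base case is 36 <
    (3/2)^11. *)
Lemma linear_lt_pow (d : nat) : (6 <= d)%nat -> 6 * INR d < (3 / 2) ^ (2 * d - 1).
Proof.
  intros Hd. induction Hd as [| d Hd IH].
  - simpl. lra.
  - replace (2 * S d - 1)%nat with (2 + (2 * d - 1))%nat by lia.
    rewrite pow_add, S_INR. apply le_INR in Hd. simpl INR in Hd. nra.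
Qed.

Theorem claim1p6 :
  exists (K : R) (d0 : nat),
    0 < K /\ (1 <= d0)%nat /\
    forall d : nat, (d0 <= d)%nat ->
      1 / cap_frac d (cap_eta d (PI / 2))
      < 2 * (PI / 2) ^ (2 * d - 1) * exp (INR d * ln (INR d) / 2)
        * (1 + K / INR d).
Proof.
  (* The main term alone dominates from 6 on, the threshold of [linear_lt_pow], so any positive K
     serves. *)
  exists 1, 6%nat. split; [lra |]. split; [lia |]. intros d Hd.
  assert (Hfrac := inv_cap_frac_le d ltac:(lia)).
  assert (Hsqrt := sqrt_succ_pow_le d ltac:(lia)).
  assert (Hlin := linear_lt_pow d Hd).
  assert (Hpow : (3 / 2) ^ (2 * d - 1) <= (PI / 2) ^ (2 * d - 1)).
  { apply pow_incr. assert (h := PI2_3_2). lra. }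
  assert (Hd0 : 0 < INR d) by (apply lt_0_INR; lia).
  assert (Hi : 0 < 1 / INR d) by (apply Rdiv_lt_0_compat; lra).
  assert (HE := exp_pos (INR d * ln (INR d) / 2)).
  set (E := exp _) in *. set (P := (PI / 2) ^ _) in *.
  apply Rle_lt_trans with (1 := Hfrac).
  (* With [PI <= 4] the bound becomes 12 d E = 2 (6 d) E, and 6 d < P. *)
  apply Rle_lt_trans with (4 * (INR d * (3 * E))).
  { apply Rmult_le_compat.
    - left; exact PI_RGT_0.
    - apply Rmult_le_pos; [lra | apply pow_le, sqrt_pos].
    - exact PI_4.
    - apply Rmult_le_compat_l; lra. }
  assert (HPE : 0 < (P - 6 * INR d) * E) by (apply Rmult_lt_0_compat; lra).
  assert (0 < 2 * P * E * (1 / INR d)) by (repeat apply Rmult_lt_0_compat; lra).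
  lra.
Qed.
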